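(* Let $T$ be a tree with $n$ vertices and fix an integer $k\ge1$. Then \[\mathrm{Tmd}_k(T)\ge\left\lceil\frac{3n-3\sum_{v\in F_T}\sum_{j=1}^{L_v}\ell(v,j)+k^2+k+\mathbb{1}_{k\equiv 1\pmod 3}}{k^2+4k+3+\mathbb{1}_{k\equiv 1\pmod 3}}\right\rceil+\sum_{v\in F_T}R(\mathcal{L}_v)-|F_T|.\]
   Context: For a graph let $d$ be the graph distance and $d_k(x,y)=\min\{d(x,y),k+1\}$. A threshold-$k$ resolving set of $G=(V,E)$ is a set $S\subseteq V$ such that for every pair of distinct $x,y\in V$ some $s\in S$ has $d_k(s,x)\ne d_k(s,y)$, and for every $x\in V$ some $s\in S$ has $d(s,x)\le k$; $\mathrm{Tmd}_k(G)$ is the minimum size of such a set. A path $P$ in $G$ is a leaf-path starting at $v$ if $P$ is the induced subgraph on $V(P)$, one end vertex is a leaf of $G$, the other end vertex $v$ has degree at least 3, and all other vertices of $P$ have degree 2; its length is its number of edges. For a vertex $v$ with $\deg v\ge 3$, $\mathcal{L}_v=\{P^{(v)}_1,\dots,P^{(v)}_{L_v}\}$ is the collection of leaf-paths starting at $v$, $L_v=|\mathcal{L}_v|$, and $\ell(v,j)$ is the length of $P^{(v)}_j$. $F_T=\{v\in T:\deg(v)\ge3,\ L_v\ge 2\}$. For an integer $\ell\ge1$ write $\ell=q(3k+2)+r$ with $q\ge0$, $0\le r\le 3k+1$, and set $\bar c(\ell)=2q+\mathbb{1}_{r\ge1}+\mathbb{1}_{r\ge 2k+2}$, $\underline c(\ell)=2q+\mathbb{1}_{r\ge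 k+1}+\mathbb{1}_{r\ge 2k+2}$. Finally $R(\mathcal{L}_v)=\sum_{j=1}^{L_v}\bar c(\ell(v,j))-\max_{1\le j\le L_v}\{\bar c(\ell(v,j))-\underline c(\ell(v,j))\}$. *)

(* Defs.v *)
From mathcomp Require Import all_boot all_order all_algebra.

Set Implicit Arguments.
Unset Strict Implicit.
Unset Printing Implicit Defensive.

(* A finite simple graph is a symmetric irreflexive relation on a finType. *)

Section Graphs.

Variables (T : finType) (e : rel T).

(* A cycle of a simple graph has at least three vertices; an edge x -- y
   traversed back and forth is a ucycle [:: x; y], hence the bound. *)
Definition is_tree : Prop :=
  [/\ symmetric e, irreflexive e, 0 < #|T|,
      forall x y, connect e x y
    & forall c : seq T, ucycle e c -> size c <= 2].

Definition deg (x : T) : nat := #|[set y | e x y]|.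

Definition walk (n : nat) (x y : T) : bool :=
  [exists p : n.-tuple T, path e x p && (last x p == y)].

(* The least length of a walk from x to y; #|T| stands for infinity, which
   does not occur in a connected graph, where all distances are < #|T|. *)
Definition dist (x y : T) : nat :=
  find (fun n => walk n x y) (iota 0 #|T|).

Definition distk (k : nat) (x y : T) : nat := minn (dist x y) k.+1.

Definition resolving (k : nat) (S : {set T}) : bool :=
  [forall x, forall y, (x != y) ==>
     [exists s in S, distk k s x != distk k s y]]
  && [forall x, [exists s in S, dist s x <= k]].

Lemma resolving_setT (k : nat) : resolving k [set: T].
Proof.
have d0 x : dist x x = 0.
  rewrite /dist; have: 0 < #|T| by apply/card_gt0P; exists x.
  case: #|T| => //= m _; suff ->: walk 0 x x by [].
  by apply/existsP; exists [tuple]; rewrite /= eqxx.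
have d_eq0 x y : dist x y = 0 -> x = y.
  rewrite /dist; have: 0 < #|T| by apply/card_gt0P; exists x.
  case: #|T| => //= m _; case: ifP => // /existsP[p] /andP[_].
  by rewrite (tuple0 p) => /eqP.
apply/andP; split.
  apply/forallP => x; apply/forallP => y; apply/implyP => nxy.
  apply/existsP; exists x; rewrite inE /= /distk d0 min0n.
  case E: (dist x y) => [|m]; last by rewrite minnSS.
  by rewrite (d_eq0 _ _ E) eqxx in nxy.
by apply/forallP => x; apply/existsP; exists x; rewrite inE d0.
Qed.

Definition Tmd (k : nat) : nat :=
  #|[arg min_(S < [set: T] | resolving k S) #|S|]|.

Lemma TmdP (k : nat) :
  (exists2 S : {set T}, resolving k S & #|S| = Tmd k)
  /\ (forall S : {set T}, resolving k S -> Tmd k <= #|S|).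
Proof.
rewrite /Tmd; case: arg_minnP => [|S rS minS]; first exact: resolving_setT.
by split=> //; exists S.
Qed.

(* A leaf-path, being induced, is determined by its vertex set P, so it is
   represented by P.  It starts at v when v :: p enumerates P in path order
   from v for some p; behead (belast v p) lists the internal vertices. *)
Definition leaf_path (v : T) (P : {set T}) : bool :=
  [exists p : #|P|.-1.-tuple T,
    [&& P == [set x in v :: p], uniq (v :: p), path e v p,
        [forall i : 'I_#|P|, forall j : 'I_#|P|,
           e (nth v (v :: p) i) (nth v (v :: p) j) ==>
             ((i.+1 == j :> nat) || (j.+1 == i :> nat))],
        3 <= deg v, deg (last v p) == 1
      & all (fun x => deg x == 2) (behead (belast v p))]].

Definition leaf_paths (v : T) : {set {set T}} := [set P | leaf_path v P].

Definition path_length (P : {set T}) : nat := #|P|.-1.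

Definition FT : {set T} := [set v | (3 <= deg v) && (2 <= #|leaf_paths v|)].

End Graphs.

Definition cbar (k l : nat) : nat :=
  let q := l %/ (3 * k + 2) in
  let r := l %% (3 * k + 2) in
  2 * q + (1 <= r) + (2 * k + 2 <= r).

Definition cund (k l : nat) : nat :=
  let q := l %/ (3 * k + 2) in
  let r := l %% (3 * k + 2) in
  2 * q + (k + 1 <= r) + (2 * k + 2 <= r).

(* Hence the truncated subtraction in Rcost is exact. *)
Lemma cund_le_cbar (k l : nat) : cund k l <= cbar k l.
Proof.
rewrite /cund /cbar leq_add2r leq_add2l addn1.
by case: ltnP => // /(leq_ltn_trans (leq0n k)) ->.
Qed.

Definition Rcost (T : finType) (k : nat) (L : {set {set T}}) : int :=
  (Posz (\sum_(P in L) cbar k (path_length P)) -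
   Posz (\max_(P in L) (cbar k (path_length P) - cund k (path_length P))%N))%R.

(* Main.v *)
(* Every sensor on a leaf-path at v sees the rest of the tree through v.  Hence,
   if S resolves T, then trimming the leaf-paths at the vertices of F_T, and
   replacing the sensors on them by one sensor at each v in F_T, leaves a
   resolving set of the trimmed tree.  A leaf-path of length l carries at least
   cund l sensors, and at least cbar l if one of them covers its first vertex;
   two leaf-paths at v cannot both fail the latter, as their first vertices must
   be told apart.  So at least R(L_v) sensors were removed at v.

   It remains to bound a set X of vertices resolved by m sensors.  Let s be the
   sensor closest to x (ties broken by a total order).  If x sees, within k, only
   sensors behind s, then d(x, s) determines x, and there are at most m (k + 1)
   such x.  Otherwise pick a sensor u not behind s, within k of x, for which the
   path from s to u passes closest to x, breaking ties by d(x, u).  Then x is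
   determined by {s, u} and its distances to s and u, because a sensor telling
   apart x and y with the same data would be a better choice for one of them.
   Moreover the Voronoi cells of s and u are adjacent, so at most m - 1 pairs
   {s, u} occur, the cells being connected.  A pair at distance D admits at most
   (k^2 + k + 1[k = 1 mod 3]) / 3 pairs of distances; the count is largest near
   D = 2 (k + 2) / 3. *)

Require Import Defs.
From mathcomp Require Import all_boot all_order all_algebra.
From mathcomp Require Import zify.

Set Implicit Arguments.
Unset Strict Implicit.
Unset Printing Implicit Defensive.

(** * The tree metric *)

Section TreeDist.

Variables (T : finType) (e : rel T).
Hypothesis tree : is_tree e.

Local Notation d := (dist e).

Lemma tree_sym : symmetric e. Proof. by case: tree. Qed.
Lemma tree_irr : irreflexive e. Proof. by case: tree. Qed.
Lemma tree_connected x y : connect e x y. Proof. by case: tree. Qed.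
Lemma tree_acyclic (c : seq T) : ucycle e c -> size c <= 2.
Proof. by case: tree => _ _ _ _; apply. Qed.

Lemma walkP n x y :
  reflect (exists p : seq T, [/\ size p = n, path e x p & last x p = y])
          (walk e n x y).
Proof.
apply: (iffP existsP) => [[p /andP[pp /eqP lp]]|[p [sp pp lp]]].
  by exists p; rewrite size_tuple.
by exists (tcast sp (in_tuple p)); rewrite val_tcast /= pp lp eqxx.
Qed.

Lemma dist_le_walk n x y : walk e n x y -> d x y <= n.
Proof.
move=> w; case: (ltnP n #|T|) => [nT|]; last first.
  by apply: leq_trans; rewrite /dist -[X in _ <= X](size_iota 0) find_size.
rewrite leqNgt; apply/negP => /(before_find 0).
by rewrite nth_iota // add0n w.
Qed.

Lemma walk_dist x y : walk e (d x y) x y.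
Proof.
have /connectP[p0 pp0 yE] := tree_connected x y.
(* A duplicate-free path has length below [#|T|], so the search in [dist] succeeds. *)
case: (shortenP pp0) yE => p pp up _ yE.
have hasw : has (fun n => walk e n x y) (iota 0 #|T|).
  apply/hasP; exists (size p); last by apply/walkP; exists p.
  by rewrite mem_iota /= add0n (leq_trans _ (max_card [in x :: p])) // (card_uniqP up).
have := nth_find 0 hasw; rewrite nth_iota ?add0n //.
by rewrite -[X in _ < X](size_iota 0) -has_find.
Qed.

Lemma distxx x : d x x = 0.
Proof.
by apply/eqP; rewrite -leqn0 dist_le_walk //; apply/walkP; exists [::].
Qed.

Lemma dist_eq0 x y : d x y = 0 -> x = y.
Proof.
by move=> dxy; have := walk_dist x y; rewrite dxy => /walkP[[|a p] []].
Qed.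

Lemma dist_triangle z x y : d x y <= d x z + d z y.
Proof.
have /walkP[p [<- pp lp]] := walk_dist x z.
have /walkP[q [<- pq lq]] := walk_dist z y.
apply: dist_le_walk; apply/walkP; exists (p ++ q).
by rewrite size_cat cat_path last_cat pp lp pq lq.
Qed.

Lemma dist_sym x y : d x y = d y x.
Proof.
suff le a b : d a b <= d b a by apply/eqP; rewrite eqn_leq !le.
have /walkP[p [sp pp lp]] := walk_dist b a.
apply: dist_le_walk; apply/walkP; exists (rev (belast b p)).
split; first by rewrite size_rev size_belast.
  rewrite -lp rev_path; move: pp; rewrite (@eq_path _ e (fun u w => e w u)) // => u w.
  exact: tree_sym.
by case: p sp pp lp => [|c p] //= _ _ _; rewrite rev_cons last_rcons.
Qed.

Lemma dist_edge x y : e x y -> d x y = 1.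
Proof.
move=> exy; apply/eqP; rewrite eqn_leq dist_le_walk /=; last first.
  by apply/walkP; exists [:: y]; rewrite /= exy.
rewrite lt0n; apply/negP => /eqP /dist_eq0 xy.
by rewrite xy tree_irr in exy.
Qed.

Lemma edge_toward r x : x != r -> exists2 y, e x y & d r x = (d r y).+1.
Proof.
move=> xr; have /walkP[[|y p] [/= sp pp lp]] := walk_dist x r.
  by rewrite lp eqxx in xr.
case/andP: pp => exy pp; exists y => //.
have : d y r <= size p by apply: dist_le_walk; apply/walkP; exists p.
have := dist_triangle y x r; rewrite (dist_edge exy).
rewrite [d r x]dist_sym [d r y]dist_sym; lia.
Qed.

Lemma dist_edge_le r x y : e x y -> d r x <= (d r y).+1.
Proof.
by move=> exy; rewrite -addn1 (leq_trans (dist_triangle y _ _)) //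
  [d y x]dist_sym (dist_edge exy).
Qed.

(* Two neighbours of x joined outside x would close a cycle through x. *)
Lemma neighbour_separated x y1 y2 : e x y1 -> e x y2 ->
  connect [rel u w | e u w && (w != x)] y1 y2 -> y1 = y2.
Proof.
move=> e1 e2 /connectP[p0 pp0 yE].
case: (shortenP pp0) yE => p pp up _ yE {p0 pp0}.
have xp : x \notin p.
  elim: p y1 pp {up yE e1} => //= a p IH y1 /andP[/andP[_ ax] pp].
  by rewrite inE negb_or eq_sym ax (IH a).
have pe : path e y1 p by apply: sub_path pp => u w /andP[].
have : size [:: x, y1 & p] <= 2.
  apply: tree_acyclic; rewrite /ucycle /= rcons_path pe e1 -yE tree_sym e2 /=.
  rewrite inE negb_or xp andbT -/(uniq (y1 :: p)) up andbT.
  by apply/negP => /eqP xy; rewrite xy tree_irr in e1.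
by case: p yE {pp up xp pe}.
Qed.

(** Each step from [y] towards [r] lands strictly closer to [r] than [x] is, so it never meets
    [x]. *)
Lemma connect_away r x y : x != y -> d r y <= d r x ->
  connect [rel u w | e u w && (w != x)] y r.
Proof.
move: {2}(d r y) (erefl (d r y)) => n.
elim: n y => [|n IH] y dn xy le; first by rewrite (dist_eq0 dn) connect0.
have yr : y != r by apply/eqP => yr; rewrite yr distxx in dn.
have [z eyz dz] := edge_toward yr.
have zx : x != z by apply/eqP => zx; rewrite zx in le; lia.
apply: connect_trans (IH z _ zx _); [|lia|lia].
by apply: connect1; rewrite /= eyz eq_sym.
Qed.

Lemma toward_unique r x y1 y2 : e x y1 -> e x y2 ->
  d r y1 <= d r x -> d r y2 <= d r x -> y1 = y2.
Proof.
have ne y : e x y -> x != y by apply: contraTneq => <-; rewrite tree_irr.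
move=> e1 e2 d1 d2.
(* the geodesics from y1 and y2 to r both avoid x *)
have c1 := connect_away (ne _ e1) d1.
have c2 := connect_away (ne _ e2) d2.
case: (eqVneq r x) => [rx|rx].
  move: d1; rewrite rx distxx leqn0 => /eqP /dist_eq0 xy.
  by rewrite -xy tree_irr in e1.
apply: (neighbour_separated e1 e2).
apply: connect_trans c1 _; move: (ne _ e2) => x2.
have /connectP[p pp ->] := c2.
elim: p y2 pp x2 {e2 d2 c2} => [|a p IH] y2 /=; first by rewrite connect0.
case/andP=> /andP[ea ax] pp x2; have xa : x != a by rewrite eq_sym.
apply: connect_trans (IH a pp xa) _.
by apply: connect1; rewrite /= tree_sym ea eq_sym.
Qed.

Lemma dist_edge_dir r x y : e x y -> d r y = (d r x).+1 \/ d r x = (d r y).+1.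
Proof.
move=> exy; have := dist_edge_le r exy; rewrite tree_sym in exy.
have := dist_edge_le r exy; rewrite tree_sym in exy.
have [xr|xr] := eqVneq x r.
  by subst r; rewrite (dist_edge exy) distxx; left.
have [z exz dz] := edge_toward xr => l1 l2.
have [le|] := leqP (d r y) (d r x); last lia.
have -> := toward_unique exy exz le ltac:(lia); lia.
Qed.

(** The edge separates [y] from [z]. Induction pushes it towards [y], and [toward_unique] shows that
    it still separates them. *)
Lemma dist_through_edge x x' y z : e x x' ->
  d y x' < d y x -> d z x < d z x' -> d y z = d y x + d x z.
Proof.
move: {2}(d y x') (erefl (d y x')) => n; elim: n x x' => [|n IH] x x' dn exx ly lz.
  have yx := dist_eq0 dn; subst y.
  have := dist_edge_dir z exx; rewrite ![d z _]dist_sym in lz *.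
  by rewrite [d x' x]dist_sym (dist_edge exx); lia.
have xy : x' != y by apply/eqP => xy; rewrite xy distxx in dn.
have [w exw dw] := edge_toward xy.
have ex'x : e x' x by rewrite tree_sym.
have lw : d z x' < d z w.
  rewrite ltnNge; apply/negP => lw.
  have wx := toward_unique exw ex'x lw (ltnW lz); subst w; lia.
rewrite (IH x' w) //; try lia.
have := dist_edge_dir y exx; have := dist_edge_dir z exx.
have := dist_sym x z; have := dist_sym x' z; lia.
Qed.

(** Induction moves [x] one step towards [y]. If this approaches both [z] and [w], all three sums
    drop by one; otherwise [x] lies between [y] and one of [z], [w], and the triangle inequality
    suffices. *)
Lemma dist_four_point x y z w :
  d x y + d z w <= maxn (d x z + d y w) (d x w + d y z).
Proof.
move: {2}(d y x) (erefl (d y x)) => n; elim: n x => [|n IH] x dn.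
  rewrite -(dist_eq0 dn) distxx; have := dist_triangle y z w.
  rewrite [d z y]dist_sym; lia.
have xy : x != y by apply/eqP => xy; rewrite xy distxx in dn.
have [x' exx dx] := edge_toward xy.
have := IH x' ltac:(lia).
have hz := dist_edge_dir z exx; have hw := dist_edge_dir w exx.
have tz := dist_triangle x z w; have tw := dist_triangle x w z.
have Bz : d z x < d z x' -> d y z = d y x + d x z.
  by apply: dist_through_edge; rewrite ?dx.
have Bw : d w x < d w x' -> d y w = d y x + d x w.
  by apply: dist_through_edge; rewrite ?dx.
have := dist_sym x y; have := dist_sym x' y; have := dist_sym x z.
have := dist_sym x' z; have := dist_sym x w; have := dist_sym x' w.
have := dist_sym z w; have := dist_sym y z; have := dist_sym y w; lia.
Qed.

Lemma dist_parity x y z : ~~ odd (d x y + d y z + d x z).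
Proof.
move: {2}(d y x) (erefl (d y x)) => n; elim: n x => [|n IH] x dn.
  by rewrite -(dist_eq0 dn) distxx; lia.
have xy : x != y by apply/eqP => xy; rewrite xy distxx in dn.
have [x' exx dx] := edge_toward xy.
have := IH x' ltac:(lia).
have := dist_edge_dir z exx.
have := dist_sym x y; have := dist_sym x' y.
have := dist_sym x z; have := dist_sym x' z; lia.
Qed.

End TreeDist.

(** * Distance pairs along a path *)

Section Counting.

(** The lexicographic order on (f, g, h) is encoded in base [N], which exceeds all values of [g] and
    [h]. *)
Lemma lexmin (U : finType) (A : {set U}) (f g h : U -> nat) u0 : u0 \in A ->
  exists2 u, u \in A & forall w, w \in A ->
    f u <= f w /\ (f w <= f u -> g u <= g w /\ (g w <= g u -> h u <= h w)).
Proof.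
move=> Au0; pose N := (\sum_w (g w + h w)).+1.
have lt w : g w < N /\ h w < N.
  by rewrite /N (bigD1 w) //=; lia.
case: (arg_minnP (fun w => (f w * N + g w) * N + h w) Au0) => u Au min.
exists u => // w /min le; have := lt u; have := lt w; nia.
Qed.

Lemma card_inj_seq (U : finType) (V : eqType) (A : {set U}) (f : U -> V) s :
  {in A &, injective f} -> {in A, forall x, f x \in s} -> #|A| <= size s.
Proof.
move=> inj sub; rewrite cardE -(size_map f); apply: uniq_leq_size.
  by rewrite map_inj_in_uniq ?enum_uniq // => x y;
     rewrite !mem_enum; apply: inj.
by move=> _ /mapP[x xA ->]; apply: sub; rewrite mem_enum in xA.
Qed.

Lemma card_fibers (U V : finType) (A : {set U}) (B : {set V}) (f : U -> V) m :
  {in A, forall x, f x \in B} ->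
  (forall y, y \in B -> #|[set x in A | f x == y]| <= m) -> #|A| <= #|B| * m.
Proof.
move=> sub le; rewrite -sum1_card (partition_big f (mem B)) //=.
rewrite -sum_nat_const; apply: leq_sum => y By.
by apply: leq_trans (le y By); rewrite -sum1_card (eq_bigl _ _ (in_set _)).
Qed.

(* The distance pairs realisable by a vertex which hangs at height h off the
   j-th inner vertex of a path of length D, both distances being at most k. *)
Definition band k D : seq (nat * nat) :=
  [seq (j + h, D - j + h) | j <- index_iota 1 D,
                            h <- iota 0 (k.+1 - maxn j (D - j))].

Lemma mem_band k D a b : a <= k -> b <= k -> a < b + D -> b < a + D ->
  D <= a + b -> ~~ odd (a + b + D) -> (a, b) \in band k D.
Proof.
move=> ak bk ab ba Dab par; apply/allpairsPdep.
have [j [h [aE bE hj jD]]] :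
    exists j h, [/\ a = j + h, b = D - j + h, 0 < j & j < D].
  (* These are the position of the foot on the path and the height above it; parity makes both
     halvings exact. *)
  exists ((a + D - b)./2), ((a + b - D)./2); split; lia.
exists j, h; rewrite aE bE mem_index_iota mem_iota hj jD; split=> //; lia.
Qed.

Let F k D := \sum_(1 <= j < D) (k.+1 - maxn j (D - j)).

Lemma size_bandE k D : size (band k D) = F k D.
Proof.
rewrite size_allpairs_dep sumnE big_map.
by apply: eq_bigr => j _; rewrite size_iota.
Qed.

(** The end terms j = 1 and j = D + 1 both equal k + 1 - D; the inner ones shift to those of
    [F k D]. *)
Let F_rec k D : 0 < D -> F k.+1 D.+2 = F k D + 2 * (k.+1 - D).
Proof.
move=> D0; rewrite /F big_ltn // big_nat_recr //= big_add1 /=.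
rewrite (eq_big_nat _ _ (F2 := fun j => k.+1 - maxn j (D - j))); first lia.
by move=> j; lia.
Qed.

Let F_odd k p : 2 * p <= k -> F k (2 * p).+1 + p * (3 * p + 1) = 2 * p * k.+1.
Proof.
elim: p k => [|p IH] k le; first by rewrite /F big_geq.
case: k le => [|k] le; first lia.
rewrite (_ : 2 * p.+1 = (2 * p).+2) ?F_rec //; last lia.
by have := IH k ltac:(lia); set f := F _ _; nia.
Qed.

Let F_even k p : 2 * p < k ->
  F k (2 * p).+2 + 3 * p * p + 4 * p + 1 = (2 * p + 1) * k.+1.
Proof.
elim: p k => [|p IH] k le.
  by rewrite /F big_ltn // big_geq //; lia.
case: k le => [|k] le; first lia.
rewrite (_ : 2 * p.+1 = (2 * p).+2) ?F_rec //; last lia.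
by have := IH k ltac:(lia); set f := F _ _; nia.
Qed.

Lemma size_band k D : 3 * size (band k D) <= k ^ 2 + k + (k %% 3 == 1).
Proof.
rewrite size_bandE; elim: k D => [|k IH] D.
  rewrite /F big1_seq // => j; rewrite mem_index_iota; lia.
have [lt|ge] := ltnP k.+2 D.
  case: D lt => [|[|D]] lt //; rewrite F_rec; last lia.
  by have := IH D; have := divn_eq k 3; nia.
have [->|D0] := posnP D; first by rewrite /F big_geq.
have := odd_double_half D; rewrite -muln2; move: D./2 => p; case: odd => DE.
  have {}DE : D = (2 * p).+1 by lia.
  rewrite DE in ge *; have := @F_odd k.+1 p; set f := F _ _ => h.
  (* The slack is (k + 1 - 3p)(k + 2 - 3p), a product of consecutive integers. *)
  have {}h := h ltac:(lia); suff : 3 * f <= k.+1 ^ 2 + k.+1 by lia.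
  have [] := leqP (3 * p) k.+1; nia.
case: p DE => [|p] DE; first lia.
have {}DE : D = (2 * p).+2 by lia.
rewrite DE in ge *; have := @F_even k.+1 p; set f := F _ _ => h.
have {}h := h ltac:(lia).
(* Without the indicator the slack is (k + 1 - 3p)(k - 1 - 3p), negative only at k = 3p, where it is
   -1; there the threshold k + 1 is 1 modulo 3. *)
have [lt|gt|kE] := ltngtP k (3 * p); last by rewrite kE; nia.
  by suff : 3 * f <= k.+1 ^ 2 + k.+1; [lia | nia].
by suff : 3 * f <= k.+1 ^ 2 + k.+1; [lia | nia].
Qed.

End Counting.

(** * Sets resolved by a given set of sensors *)

Section TruncatedResolving.

Variables (T : finType) (e : rel T).
Hypothesis tree : is_tree e.

Local Notation d := (dist e).

(* Arguments kept in the order x, y, z, w, so that lia sees the same atoms. *)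
Lemma four_points x y z w :
  d x y + d z w <= maxn (d x z + d y w) (d x w + d y z) /\
  d x z + d y w <= maxn (d x y + d z w) (d x w + d y z) /\
  d x w + d y z <= maxn (d x y + d z w) (d x z + d y w).
Proof.
have := dist_four_point tree x y z w; have := dist_four_point tree x z y w.
have := dist_four_point tree x w y z.
have := dist_sym tree z y; have := dist_sym tree w y; have := dist_sym tree w z.
lia.
Qed.

Lemma three_points x y z :
  d x y <= d x z + d y z /\ d x z <= d x y + d y z /\ d y z <= d x y + d x z.
Proof.
have := dist_triangle tree z x y; have := dist_triangle tree y x z.
have := dist_triangle tree x y z.
have := dist_sym tree z y; have := dist_sym tree y x; lia.
Qed.

Variables (k : nat) (X S : {set T}).

Definition rank (x : T) : nat := enum_rank x.

Lemma rank_inj x y : rank x <= rank y -> rank y <= rank x -> x = y.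
Proof.
by move=> xy yx; apply/enum_rank_inj/val_inj/eqP; rewrite eqn_leq xy.
Qed.

Hypothesis covered : forall x, x \in X -> exists2 s, s \in S & d x s <= k.
Hypothesis resolved : forall x y, x \in X -> y \in X -> x != y ->
  exists2 s, s \in S & minn (d x s) k.+1 != minn (d y s) k.+1.

Variable near : T -> T.
Hypothesis near_in : forall x, near x \in S.
Hypothesis near_min : forall x u, u \in S ->
  d x (near x) <= d x u /\ (d x u <= d x (near x) -> rank (near x) <= rank u).

(* The last condition says that the path from x to u avoids near x. *)
Definition sighted x u :=
  [&& u \in S, d x u <= k & d x u < d x (near x) + d (near x) u].

Variable second : T -> T.
(* d x (near x) + d x u - d (near x) u is twice the distance from x to the path
   from near x to u; breaking its ties by the distance to u is what makes the
   cells of near x and second x adjacent. *)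
Hypothesis second_sighted : forall x u, sighted x u -> sighted x (second x).
Hypothesis second_min : forall x u, sighted x u ->
  let s := near x in let v := second x in
  d x v + d s u <= d x u + d s v /\
  (d x u + d s v <= d x v + d s u ->
   d x v <= d x u /\ (d x u <= d x v -> rank v <= rank u)).

(** A sensor preferred to [near x] at [z] would be preferred at [x] too. Thus cells are
    connected. *)
Lemma near_between x z : d x z + d z (near x) = d x (near x) -> near z = near x.
Proof.
move=> bt; have [] := near_min z (near_in x); have [] := near_min x (near_in z).
have [? [? ?]] := three_points x z (near z).
by move=> h1 h2 h3 h4; apply: rank_inj; [apply: h4 | apply: h2]; lia.
Qed.

Lemma near_sensor s : s \in S -> near s = s.
Proof.
move=> Ss; have [] := near_min s Ss; rewrite distxx => d0 _.
by apply/esym/(dist_eq0 tree); lia.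
Qed.

(** A third sensor [w] nearest to [z] would be sighted from [x], with a path from [near x] passing
    no farther from [x] and with [w] no farther than [second x]; the rank then identifies the
    two. *)
Lemma near_toward_second x z : sighted x (second x) ->
  d x z + d z (second x) = d x (second x) ->
  near z = near x \/ near z = second x.
Proof.
set s := near x; set u := second x; set w := near z => sx bt.
have [su xuk xu] := and3P sx; rewrite -/s -/u in su xuk xu bt.
case: (eqVneq w s) => [|ws]; first by left.
case: (eqVneq w u) => [|wu]; first by right.
have sS : s \in S by apply: near_in.
have wS : w \in S by apply: near_in.
have [zs1 zs2] := near_min z sS; have [zu1 zu2] := near_min z su.
have [xw1 xw2] := near_min x wS; rewrite -/w -/s in zs1 zs2 zu1 zu2 xw1 xw2.
have sw0 : d s w <> 0 by move/(dist_eq0 tree) => sw; rewrite sw eqxx in ws.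
have [f1 [f2 f3]] := four_points x z s w.
have xwk : d x w <= k by have [_ [le _]] := three_points x z w; lia.
have xw : d x w < d x s + d s w.
  rewrite ltnNge; apply/negP => ge.
  have [_ [_ le]] := three_points z s u; have sym := dist_sym tree z s.
  clear f1 f2 xw2 zu2 zs2; lia.
have cw : sighted x w by rewrite /sighted wS xwk.
have [g1 g2] := second_min cw; rewrite -/s -/u in g1 g2.
have le : d x w + d s u <= d x u + d s w.
  rewrite leqNgt; apply/negP => gt.
  have [_ [_ g3]] := four_points x s u w.
  have [_ [_ tu]] := three_points z u w.
  have [ws0 sw1] : d x w <= d x s /\ d z s <= d z w by lia.
  by move/eqP: ws; apply; apply: rank_inj; [apply: zs2 | apply: xw2].
have [ux uw] := g2 le.
by case/eqP: wu; apply: rank_inj; [apply: zu2 | apply: uw];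
   have [_ [tu _]] := three_points x z w; lia.
Qed.

Lemma sighted_neq x u : sighted x u -> near x != u.
Proof.
case/and3P=> _ _ lt; apply/eqP => xu.
by rewrite xu distxx addn0 ltnn in lt.
Qed.

(** * The tree of cells *)

Variable r : T.

(* The cells {z | near z = s}, s in S, form a tree once contracted; child c p
   says that p is the parent of c when this tree is rooted at the cell of r. *)
Definition child c p := exists z z',
  [/\ e z z', near z = c, near z' = p, c != p & d r z = (d r z').+1].

(** On the way from [x] to [second x], the first edge leaving the cell of [near x] enters that of
    [second x]. *)
Lemma child_second x : sighted x (second x) ->
  child (near x) (second x) \/ child (second x) (near x).
Proof.
move=> sx; have su := sighted_neq sx; have [uS _ _] := and3P sx.
have nu := near_sensor uS.
suff H n z : d z (second x) = n -> d x z + d z (second x) = d x (second x) ->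
    near z = near x ->
    child (near x) (second x) \/ child (second x) (near x).
  by apply: (H _ x); rewrite ?distxx.
elim: n z => [|n IH] z dn bt nz.
  by move/(dist_eq0 tree): dn => zu; rewrite -nz zu nu eqxx in su.
have zu : z != second x by apply/eqP => zu; rewrite zu distxx in dn.
have [z' ezz' dz'] := edge_toward tree zu.
have s1 := dist_sym tree z (second x); have s2 := dist_sym tree z' (second x).
have bt' : d x z' + d z' (second x) = d x (second x).
  have := dist_edge_le tree x (_ : e z' z); rewrite (tree_sym tree) ezz'.
  by move=> /(_ isT); have := dist_triangle tree z' x (second x); lia.
have [nz'|nz'] := near_toward_second sx bt'; first by apply: (IH z') => //; lia.
have [dr|dr] := dist_edge_dir tree r ezz'.
  by right; exists z', z; rewrite (tree_sym tree) eq_sym.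
by left; exists z, z'.
Qed.

(** If [z'] were on the way from [z] to [near z], [near_between] would put both in one cell. *)
Lemma child_edge z z' : e z z' -> near z != near z' -> d r z = (d r z').+1 ->
  d z' (near z) = (d z (near z)).+1 /\ d r z' + d z' (near z) = d r (near z).
Proof.
move=> ezz' nn dz; set s := near z.
have d1 : d z' s = (d z s).+1.
  have := dist_edge_dir tree s ezz'.
  have := dist_sym tree z s; have := dist_sym tree z' s.
  suff : d z s <> (d z' s).+1 by lia.
  move=> eq; case/eqP: nn; apply/esym/near_between.
  by rewrite -/s (dist_edge tree ezz') eq.
split=> //; have [f _] := four_points r z z' s.
have [_ [t _]] := three_points r z' s.
have := dist_edge tree ezz'; lia.
Qed.

Lemma between_same x y a b : d x a + d a y = d x y -> d x b + d b y = d x y ->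
  d x a <= d x b -> d x a + d a b = d x b.
Proof.
move=> ba bb le; have := dist_four_point tree x y a b.
have := dist_triangle tree a x b.
have := dist_sym tree y a; have := dist_sym tree y b; lia.
Qed.

Lemma child_neq_root c p : child c p -> c != near r.
Proof.
case=> z [z' [ezz' nz nz' cp dz]]; apply/eqP => cr.
rewrite -nz -nz' in cp; have [_ bt] := child_edge ezz' cp dz.
have zr : near z = near r by rewrite nz.
by case/eqP: cp; rewrite zr; apply/esym/near_between; rewrite -zr.
Qed.

(** Both crossing edges lie on the path from [r] to [c]. If they differed, the outer end of the one
    nearer [c] would lie between [c] and a vertex of its cell, hence in that cell. *)
Lemma child_uniq c p p' : child c p -> child c p' -> p = p'.
Proof.
wlog le : p p' / exists z z' w w', [/\ [/\ e z z', near z = c, near z' = p, c != p &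
  d r z = (d r z').+1], [/\ e w w', near w = c, near w' = p', c != p' &
  d r w = (d r w').+1] & d r w' <= d r z'].
  move=> H [z [z' h]] [w [w' h']].
  case: (leqP (d r w') (d r z')) => [le|/ltnW le].
    by apply: H; [exists z, z', w, w' | exists z, z' | exists w, w'].
  by apply/esym/H; [exists w, w', z, z' | exists w, w' | exists z, z'].
case: le => z [z' [w [w' [[ez nz nz' cp dz] [ew nw nw' cp' dw] le]]]] _ _.
rewrite -nz -nz' in cp; have [a1 a2] := child_edge ez cp dz.
rewrite -nw -nw' in cp'; have [b1 b2] := child_edge ew cp' dw.
rewrite nz nw in a1 a2 b1 b2.
have [eq|ne] := eqVneq (d r w') (d r z').
  have ww := between_same b2 a2 le.
  suff wz : w' = z' by rewrite -nz' -nw' wz.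
  by apply: (dist_eq0 tree); lia.
have bw : d r w + d w c = d r c by lia.
have wz := between_same bw a2 ltac:(lia).
by case/eqP: cp; rewrite nz -nw; apply/esym/near_between; rewrite nw; lia.
Qed.

(* A sensor distinguishing x and y is thus sighted from whichever of them is
   closer to it. *)
Lemma sighted_closer x y w : w \in S -> near x = near y ->
  d x (near x) = d y (near y) -> d x w < d y w -> d x w <= k -> sighted x w.
Proof.
move=> wS nxy dxy lt wk; rewrite /sighted wS wk /= (leq_trans lt) //.
by rewrite dxy nxy dist_triangle.
Qed.

Lemma distinguished x y : x \in X -> y \in X -> x != y -> near x = near y ->
  d x (near x) = d y (near y) ->
  exists2 w, w \in S & sighted x w /\ d x w < d y w \/ sighted y w /\ d y w < d x w.
Proof.
move=> xX yX xy nxy dxy; have [w wS ne] := resolved xX yX xy; exists w => //.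
case: (ltngtP (d x w) (d y w)) => lt.
- left; split=> //; apply: (sighted_closer wS nxy dxy lt); move: lt ne; lia.
- right; split=> //; apply: (sighted_closer wS (esym nxy) (esym dxy) lt).
  by move: lt ne; lia.
by rewrite lt eqxx in ne.
Qed.

Lemma unsighted_inj x y : x \in X -> y \in X ->
  ~~ sighted x (second x) -> ~~ sighted y (second y) ->
  near x = near y -> d x (near x) = d y (near y) -> x = y.
Proof.
move=> xX yX sx sy nxy dxy; apply/eqP/negP => /negP xy.
have [w _ [[/second_sighted]|[/second_sighted]]] := distinguished xX yX xy nxy dxy.
  by rewrite (negPf sx).
by rewrite (negPf sy).
Qed.

(** Say [w] is sighted from [a] and closer to it. Minimality of [u] and the four-point condition at
    [a] bound d a s + d u w and d a u + d s w by d a w + d s u. At [b] the former sums are the same,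
    so the condition there gives d b w <= d a w. *)
Lemma second_inj x y : x \in X -> y \in X ->
  near x = near y -> second x = second y -> d x (near x) = d y (near y) ->
  d x (second x) = d y (second y) -> x = y.
Proof.
move=> xX yX nxy sxy dn ds; apply/eqP/negP => /negP xy.
suff H a b w : near a = near b -> second a = second b ->
    d a (near a) = d b (near b) -> d a (second a) = d b (second b) ->
    sighted a w -> d a w < d b w -> False.
  by have [w _ [[]|[]]] := distinguished xX yX xy nxy dn; apply: H.
move=> {x y xX yX nxy sxy dn ds xy} nab sab dn ds /second_min[]; rewrite -nab in dn.
rewrite -sab in ds; set s := near a in dn *; set u := second a in ds * => g _ lt.
have [f1 _] := four_points a s u w.
have [_ [_ f2]] := four_points b s u w; lia.
Qed.

(** * Counting unsighted and sighted vertices *)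

Let solo := [set x in X | ~~ sighted x (second x)].
Let paired := [set x in X | sighted x (second x)].

Lemma card_unsighted : #|solo| <= #|S| * k.+1.
Proof.
apply: (card_fibers (f := near)) => [x _|s sS]; first exact: near_in.
rewrite -[k.+1](size_iota 0); apply: (card_inj_seq (f := fun x => d x s)) => [x y|x].
  rewrite !inE => /andP[/andP[xX sx] /eqP xs] /andP[/andP[yX sy] /eqP ys] dxy.
  by apply: unsighted_inj; rewrite // xs ys.
rewrite !inE mem_iota => /andP[/andP[xX _] /eqP <-].
have [u uS ux] := covered xX; have [le _] := near_min x uS.
by move: le ux; lia.
Qed.

(** One band serves both roles of [c] and [p]: two vertices with equal distances but swapped roles
    would have [c] and [p] tied at both, and the rank would identify them. *)
Lemma card_sighted_pair c p (A : {set T}) :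
  (forall x, x \in A -> [/\ x \in X, sighted x (second x) &
     near x = c /\ second x = p \/ near x = p /\ second x = c]) ->
  #|A| <= size (band k (d c p)).
Proof.
move=> AP; apply: (card_inj_seq (f := fun x => (d x c, d x p))).
  move=> x y xA yA [dc dp].
  have [xX sx xcp] := AP x xA; have [yX sy ycp] := AP y yA.
  have [[xS _ _] [yS _ _]] := (and3P sx, and3P sy).
  have [lx rx] := near_min x xS; have [ly ry] := near_min y yS.
  have nx := sighted_neq sx.
  case: xcp ycp => [[xc xp]|[xp xc]] [[yc yp]|[yp yc]];
    try by apply: second_inj; rewrite // ?xc ?yc ?xp ?yp.
    case/eqP: nx; rewrite xc xp; rewrite xc xp in lx rx.
    rewrite yc yp in ly ry; apply: rank_inj; [apply: rx | apply: ry]; lia.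
  case/eqP: nx; rewrite xc xp; rewrite xc xp in lx rx.
  rewrite yc yp in ly ry; apply: rank_inj; [apply: rx | apply: ry]; lia.
move=> x /AP[xX sx xcp]; have [xS xk lt] := and3P sx.
have nx := sighted_neq sx; have [le _] := near_min x xS.
have D0 : d (near x) (second x) <> 0.
  by move/(dist_eq0 tree) => eq; rewrite eq eqxx in nx.
have [t _] := three_points (near x) (second x) x.
have par := dist_parity tree x (near x) (second x).
have := dist_sym tree (near x) x; have := dist_sym tree (second x) x.
have := dist_sym tree c p.
by case: xcp => -[xc xp]; rewrite !xc !xp in xk lt le D0 t par *; move=> *;
  apply: mem_band; lia.
Qed.

(** Each vertex is charged to the child in its pair. The root cell is never charged, and the unique
    parent makes each charged sensor stand for one pair. *)
Lemma card_sighted : #|paired| <= #|S|.-1 * ((k ^ 2 + k + (k %% 3 == 1)) %/ 3).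
Proof.
have /fin_all_exists[ch chP] : forall x, exists c, x \in paired ->
    exists2 p, child c p &
      near x = c /\ second x = p \/ near x = p /\ second x = c.
  move=> x; have [xp|/negP xp] := boolP (x \in paired); last by exists x.
  have := xp; rewrite inE => /andP[_ /child_second[]] h.
    by exists (near x) => _; exists (second x) => //; left.
  by exists (second x) => _; exists (near x) => //; right.
have -> : #|S|.-1 = #|S :\ near r| by rewrite [in LHS](cardsD1 (near r)) near_in.
apply: (card_fibers (f := ch)) => [x xp|c _].
  have [p cp xcp] := chP x xp; rewrite in_setD1 (child_neq_root cp) /=.
  move: xp; rewrite inE => /andP[_ /and3P[sS _ _]].
  by case: xcp => -[xn x2]; rewrite -?x2 // -xn.
have [-> | [x0]] := set_0Vmem [set x in paired | ch x == c]; first by rewrite cards0.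
rewrite inE => /andP[x0p /eqP x0c]; have [p cp _] := chP x0 x0p.
rewrite x0c in cp; rewrite leq_divRL // mulnC (leq_trans _ (size_band k (d c p))) //.
rewrite leq_mul2l /=; apply: card_sighted_pair => x.
rewrite inE => /andP[xp /eqP xc]; have [p' cp' xcp] := chP x xp.
rewrite xc in cp' xcp; rewrite (child_uniq cp cp').
by move: xp; rewrite inE => /andP[xX sx].
Qed.

End TruncatedResolving.

Lemma card_resolved (T : finType) (e : rel T) (k : nat) (X S : {set T}) :
  is_tree e -> 0 < #|S| ->
  (forall x, x \in X -> exists2 s, s \in S & dist e x s <= k) ->
  (forall x y, x \in X -> y \in X -> x != y ->
    exists2 s, s \in S & minn (dist e x s) k.+1 != minn (dist e y s) k.+1) ->
  3 * #|X| + (k ^ 2 + k + (k %% 3 == 1))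
    <= #|S| * (k ^ 2 + 4 * k + 3 + (k %% 3 == 1)).
Proof.
move=> tree S0 cov res; have [s0 s0S] := card_gt0P S0.
have /fin_all_exists2[near near_in near_min] : forall x, exists2 s, s \in S &
    forall u, u \in S -> dist e x s <= dist e x u /\
      (dist e x u <= dist e x s -> rank s <= rank u).
  move=> x; have [s sS min] := lexmin (dist e x) (@rank T) (fun=> 0) s0S.
  by exists s => // u uS; have [? h] := min u uS; split=> // /h[].
have /fin_all_exists2[second secP sec_min] : forall x, exists2 v,
    forall u, sighted e k S near x u -> sighted e k S near x v &
    forall u, sighted e k S near x u -> let s := near x in
      dist e x v + dist e s u <= dist e x u + dist e s v /\
      (dist e x u + dist e s v <= dist e x v + dist e s u ->
       dist e x v <= dist e x u /\ (dist e x u <= dist e x v -> rank v <= rank u)).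
  move=> x; pose A := [set u | sighted e k S near x u].
  have [A0|[u0 u0A]] := set_0Vmem A.
    have no u : ~ sighted e k S near x u.
      by move=> su; have := in_set0 u; rewrite -A0 inE su.
    by exists x => u /no.
  have [v vA min] := lexmin
    (fun u => dist e x (near x) + dist e x u - dist e (near x) u)
    (dist e x) (@rank T) u0A.
  (* This makes the truncated subtraction in the minimised quantity exact. *)
  have tri u : dist e (near x) u <= dist e x (near x) + dist e x u.
    by have [_ []] := three_points tree x (near x) u.
  exists v => u su; first by move: vA; rewrite inE.
  have [|] := min u; first by rewrite inE.
  by have := tri u; have := tri v => /= tv tu m1 m2; split; [|move=> h; apply: m2]; lia.
have Xsplit : #|X| = #|[set x in X | ~~ sighted e k S near x (second x)]|
    + #|[set x in X | sighted e k S near x (second x)]|.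
  rewrite -(cardsID [set x | sighted e k S near x (second x)] X) addnC.
  by congr (_ + _); apply: eq_card => x; rewrite !inE // andbC.
have h1 := card_unsighted tree cov res near_in near_min secP.
have h2 := card_sighted tree res near_in near_min sec_min s0.
set b := (_ %/ 3) in h2; have b3 : b * 3 = k ^ 2 + k + (k %% 3 == 1).
  rewrite /b; suff [t ->] : exists t, k ^ 2 + k + (k %% 3 == 1) = t * 3 by rewrite mulnK.
  have kE := divn_eq k 3; set q := k %/ 3 in kE.
  have [r0|[r1|r2]] : k %% 3 = 0 \/ k %% 3 = 1 \/ k %% 3 = 2 by lia.
  - by exists (3 * q ^ 2 + q); rewrite r0 in kE *; nia.
  - by exists (3 * q ^ 2 + 3 * q + 1); rewrite r1 in kE *; nia.
  by exists (3 * q ^ 2 + 5 * q + 2); rewrite r2 in kE *; nia.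
case: #|S| S0 h1 h2 Xsplit => //= m _; nia.
Qed.

(** * Leaf-paths *)

(** This and [cund_le] pay for a first sensor at position [g]. As g < 3k + 2, the quotient drops by
    at most one. *)
Lemma cbar_le k l g : g <= k.+1 -> cbar k l <= (cund k (l - g)).+1.
Proof.
move=> gk; rewrite /cbar /cund; set M := 3 * k + 2.
have M0 : 0 < M by rewrite /M; lia.
have lE := divn_eq l M; have lM := ltn_pmod l M0.
have rE := divn_eq (l - g) M; have rM := ltn_pmod (l - g) M0.
move: (l %/ M) (l %% M) ((l - g) %/ M) ((l - g) %% M) lE lM rE rM.
move=> q r q' r' lE lM rE rM.
have [lg|gl] := leqP l g.
  have -> : q = 0 by nia.
  lia.
have [q'E|q'E] : q = q' \/ q = q'.+1 by nia.
  by subst q'; lia.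
by subst q; rewrite mulSn in lE; rewrite /M in lE rE lM rM; lia.
Qed.

Lemma cund_le k l g : g <= (2 * k).+1 -> cund k l <= (cbar k (l - g)).+1.
Proof.
move=> gk; rewrite /cbar /cund; set M := 3 * k + 2.
have M0 : 0 < M by rewrite /M; lia.
have lE := divn_eq l M; have lM := ltn_pmod l M0.
have rE := divn_eq (l - g) M; have rM := ltn_pmod (l - g) M0.
move: (l %/ M) (l %% M) ((l - g) %/ M) ((l - g) %% M) lE lM rE rM.
move=> q r q' r' lE lM rE rM.
have [lg|gl] := leqP l g.
  have -> : q = 0 by nia.
  lia.
have [q'E|q'E] : q = q' \/ q = q'.+1 by nia.
  by subst q'; lia.
by subst q; rewrite mulSn in lE; rewrite /M in lE rE lM rM; lia.
Qed.

(* Positions 1, ..., l on a path whose position 0 acts as a free sensor; A is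
   the set of positions of the real sensors.  If g is the first of them, the
   part of the path beyond g satisfies the same hypotheses with g in the role
   of 0, and if g > k + 1 then telling g - 1 and g + 1 apart forces a sensor
   among the k + 1 positions after g. *)
Lemma count_path_sensors k l (A : pred nat) :
  (forall x, k < x <= l ->
     exists s, [/\ 0 < s <= l, A s, x <= s + k & s <= x + k]) ->
  (forall x y, k < x -> x < y <= l -> exists s, [/\ 0 < s <= l, A s &
     minn ((x - s) + (s - x)) k.+1 != minn ((y - s) + (s - y)) k.+1]) ->
  cund k l <= count A (iota 1 l) /\
  (forall s, 0 < s <= l -> s <= k.+1 -> A s -> cbar k l <= count A (iota 1 l)).
Proof.
elim/ltn_ind: l A => l IH A cov res.
have [lk|kl] := leqP l k.
  have ck : cund k l = 0 by rewrite /cund divn_small ?modn_small; lia.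
  rewrite ck; split=> // s sl sk As; apply: (leq_trans (cbar_le l sk)).
  have -> : cund k (l - s) = 0 by rewrite /cund divn_small ?modn_small; lia.
  by rewrite -has_count; apply/hasP; exists s; rewrite // mem_iota; lia.
have [s0 [s0l As0 _ _]] := cov l ltac:(lia).
have exA : exists s, (0 < s <= l) && A s by exists s0; rewrite s0l.
case: (ex_minnP exA) => g /andP[gl Ag] gmin {s0 s0l As0}.
pose B s := A (g + s).
have countE : (count B (iota 1 (l - g))).+1 <= count A (iota 1 l).
  have -> : l = g.-1 + (l - g).+1 by lia.
  rewrite iotaD count_cat /= (_ : 1 + g.-1 = g) ?Ag; last lia.
  rewrite (_ : g.-1 + (l - g).+1 - g = l - g); last lia.
  by rewrite -[g.+1]addn1 iotaDl count_map add1n leq_addl.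
have shift s : 0 < s <= l -> A s -> g <= s by move=> sl As; apply: gmin; rewrite sl.
have [] := IH (l - g) ltac:(lia) B.
- move=> x xl; have [s [sl As h1 h2]] := cov (g + x) ltac:(lia).
  have [sg|] := eqVneq s g; first by lia.
  move=> sg; have gs := shift s sl As; exists (s - g).
  by rewrite /B subnKC //; split=> //; lia.
- move=> x y kx xy; have [s [sl As ne]] := res (g + x) (g + y) ltac:(lia) ltac:(lia).
  have gs := shift s sl As; have [sg|sg] := eqVneq s g; first by move: ne; lia.
  by exists (s - g); rewrite /B subnKC //; split=> //; move: ne; lia.
move=> cundB cbarB; split; last first.
  move=> s sl sk As; have gs := shift s sl As.
  by apply: leq_trans (cbar_le l (_ : g <= k.+1)) _; lia.
have [gk|gk] := leqP g k.+1.
  apply: leq_trans countE; rewrite -ltnS in cundB.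
  exact: leq_trans (cund_le_cbar k l) (leq_trans (cbar_le l gk) cundB).
(* Position k + 1 must be covered, so the first sensor is at most [k] further. *)
have g2 : g <= (2 * k).+1.
  by have [s [sl As h1 h2]] := cov k.+1 ltac:(lia); have := shift s sl As; lia.
apply: leq_trans countE; apply: leq_trans (cund_le l g2) _; rewrite ltnS.
have [lg|lg] := leqP l g; first by rewrite (_ : l - g = 0) ?/cbar ?div0n ?mod0n //; lia.
have [s [sl As ne]] := res g.-1 g.+1 ltac:(lia) ltac:(lia).
have gs := shift s sl As; apply: (cbarB (s - g)); rewrite ?/B ?subnKC //.
  by move: ne; lia.
by move: ne; lia.
Qed.

Section LeafPaths.

Variables (T : finType) (e : rel T).
Hypothesis tree : is_tree e.

Local Notation d := (dist e).

(** Vertices past [v] have only path neighbours. By induction from the leaf end, the neighbour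
    towards an outside [w] is always the previous one, so [w] sees the path through [v]. *)
Lemma leaf_path_enum v P : leaf_path e v P -> exists q : nat -> T,
  let l := path_length P in
  [/\ 0 < l, q 0 = v,
      forall x, x \in P :\ v <-> exists2 i, 0 < i <= l & x = q i,
      forall i j, i <= j <= l -> d (q i) (q j) = j - i &
      forall w i, w \notin P :\ v -> i <= l -> d w (q i) = d w v + i].
Proof.
case/existsP=> p /and5P[/eqP PE up pp _ /and3P[dv dl /allP dint]].
set l := path_length P; set q := nth v (v :: p); exists q => /=.
have sp : size p = l by rewrite size_tuple.
have q_edge i : i < l -> e (q i) (q i.+1) by rewrite -sp; apply/(pathP v): i.
have q_inj i j : i <= l -> j <= l -> q i = q j -> i = j.
  move=> il jl eq; apply/eqP; rewrite -(nth_uniq v _ _ up) /= ?sp ?ltnS //.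
  exact/eqP.
have l0 : 0 < l.
  rewrite lt0n; apply/eqP => l0; move: dl dv; rewrite (last_nth v) sp l0 /=.
  by move/eqP=> ->.
have q_in x : x \in P :\ v <-> exists2 i, 0 < i <= l & x = q i.
  split=> [|[i /andP[i0 il] ->]].
    rewrite in_setD1 PE inE => /andP[xv xP]; exists (index x (v :: p)).
      have := xP; rewrite -index_mem /= sp ltnS => ->; rewrite andbT.
      by case: ifP xv => [/eqP->|//]; rewrite eqxx.
    by rewrite /q nth_index.
  rewrite in_setD1 PE inE mem_nth /= ?sp ?ltnS // andbT.
  by apply/eqP => qv; have := q_inj i 0 il (leq0n l) qv; lia.
have nbr i y : 0 < i <= l -> e (q i) y -> y = q i.-1 \/ i < l /\ y = q i.+1.
  case: i => // i /= il ey; have eb := q_edge i il.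
  rewrite (tree_sym tree) in eb.
  move: il; rewrite leq_eqVlt => /orP[/eqP il|il].
    left; move: dl; rewrite (last_nth v) sp -il -/(q i.+1) => /cards1P[z zE].
    have [] : y = z /\ q i = z by split; apply/set1P; rewrite -zE inE.
    by move=> -> ->.
  have ef := q_edge _ il; have : deg e (q i.+1) == 2.
    apply: dint; rewrite (_ : q i.+1 = nth v (behead (belast v p)) i).
      by rewrite mem_nth // size_behead size_belast sp; lia.
    by rewrite nth_behead /q lastI nth_rcons size_belast sp il.
  move/eqP=> d2.
  have : [set q i; q i.+2] == [set z | e (q i.+1) z].
    rewrite eqEcard cards2 -/(deg e (q i.+1)) d2; apply/andP; split.
      by apply/subsetP => z /set2P[]->; rewrite inE.
    by rewrite (_ : q i != q i.+2) //; apply/eqP => /q_inj; lia.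
  move/eqP/setP/(_ y); rewrite !inE ey => /orP[/eqP->|/eqP->]; first by left.
  by right.
split=> // [i j /andP[ij jl]|w i wP il].
  rewrite -(subnKC ij) in jl *; move: (j - i) jl => m {ij}; rewrite addKn.
  elim/ltn_ind: m => -[|[|m]] IH jl; first by rewrite addn0 distxx.
    by rewrite addn1; apply/(dist_edge tree)/q_edge; lia.
  have d1 := IH m ltac:(lia) ltac:(lia); have d2 := IH m.+1 ltac:(lia) ltac:(lia).
  have e1 := q_edge (i + m) ltac:(lia); have e2 := q_edge (i + m.+1) ltac:(lia).
  rewrite -addnS in e1; rewrite (tree_sym tree) in e1; rewrite -addnS in e2.
  have [d3|d3] := dist_edge_dir tree (q i) e2; first lia.
  have le1 : d (q i) (q (i + m)) <= d (q i) (q (i + m.+1)) by lia.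
  have le2 : d (q i) (q (i + m.+2)) <= d (q i) (q (i + m.+1)) by lia.
  by have := q_inj _ _ _ _ (toward_unique tree e1 e2 le1 le2); lia.
have step j : j < l -> d w (q j.+1) = (d w (q j)).+1.
  move=> jl; move: {2}(l - j.+1) (erefl (l - j.+1)) => m.
  elim: m j jl => [|m IH] j jl mE; have wq : q j.+1 != w;
    try by apply: contraNneq wP => <-; apply/q_in; exists j.+1.
    have [y ey ->] := edge_toward tree wq.
    by have [-> //|[]] := nbr _ _ (jl : 0 < j.+1 <= l) ey; lia.
  have [y ey dy] := edge_toward tree wq; rewrite dy.
  have [-> //|[jl' yE]] := nbr _ _ (jl : 0 < j.+1 <= l) ey.
  by have := IH j.+1 jl' ltac:(lia); rewrite yE in dy; lia.
elim: i il => [|i IH] il; first by rewrite addn0.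
by rewrite step // IH ?addnS // ltnW.
Qed.

Lemma leaf_path_deg v P x : leaf_path e v P -> x \in P :\ v -> deg e x <= 2.
Proof.
case/existsP=> p /and5P[/eqP PE up pp _ /and3P[dv dl /allP dint]].
rewrite in_setD1 PE inE => /andP[xv]; rewrite lastI mem_rcons inE.
case/orP=> [/eqP->|]; first by rewrite (eqP dl).
case: (tval p) xv dint => //= a s xv dint; rewrite inE (negPf xv) /= => /dint.
by move=> /eqP->.
Qed.

Lemma leaf_path_start v P : leaf_path e v P -> 3 <= deg e v.
Proof. by case/existsP=> p /and5P[_ _ _ _ /and3P[]]. Qed.

Lemma leaf_path_start_in v P : leaf_path e v P -> v \in P.
Proof.
by case/existsP=> p /and5P[/eqP PE _ _ _ _]; rewrite PE inE mem_head.
Qed.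

(** By degree, each start lies outside the other punctured path, so each sees [x] through the other,
    forcing v = v'. Then the leaf of one path lies on the other, and geodesics from [v] to it
    coincide. *)
Lemma leaf_path_disjoint v v' P P' x : leaf_path e v P -> leaf_path e v' P' ->
  x \in P :\ v -> x \in P' :\ v' -> v = v' /\ P = P'.
Proof.
move=> lP lP' xP xP'.
have notin u Q w R : leaf_path e u Q -> leaf_path e w R -> w \notin Q :\ u.
  by move=> lQ /leaf_path_start; apply: contraL => /(leaf_path_deg lQ); lia.
have sub u Q R : leaf_path e u Q -> leaf_path e u R -> x \in Q :\ u ->
    x \in R :\ u -> Q :\ u \subset R :\ u.
  move=> lQ lR xQ xR.
  have [q [l0 q0 qP qd qo]] := leaf_path_enum lQ.
  have [r [m0 r0 rP rd ro]] := leaf_path_enum lR.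
  set l := path_length Q in l0 qP qd qo; set m := path_length R in m0 rP rd ro.
  have [i il xq] := (qP x).1 xQ; have [j jl xr] := (rP x).1 xR.
  have [/andP[i0 il'] /andP[j0 jl']] := (il, jl).
  have dul := qd 0 l (leqnn l); rewrite q0 in dul.
  have zR : q l \in R :\ u.
    apply: contraT => zn; have := ro _ j zn jl'.
    have il2 : i <= l <= l by rewrite il' leqnn.
    have := qd i l il2; rewrite -xr -xq.
    have := dist_sym tree x (q l); have := dist_sym tree u (q l).
    by move: i0 j0 il' dul; clear; lia.
  have [t tm zt] := (rP _).1 zR.
  have [t0 tm'] := andP tm.
  have tl : t = l by have := rd 0 t tm'; rewrite -zt r0 dul !subn0.
  subst t; apply/subsetP => y /qP[a al ->]; have [a0 al'] := andP al.
  have am : a <= m by apply: leq_trans tm'.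
  apply/rP; exists a; first by rewrite a0.
  apply: (dist_eq0 tree); have := dist_four_point tree u (q l) (q a) (r a).
  have all2 : a <= l <= l by rewrite al' leqnn.
  have alm : a <= l <= m by rewrite al'.
  have := qd 0 a al'; have := qd a l all2; have := rd 0 a am; have := rd a l alm.
  rewrite -zt r0 q0; have := dist_sym tree (q l) (q a).
  by have := dist_sym tree (q l) (r a); move: dul al'; clear; lia.
have vv : v = v'.
  have [q [_ _ qP qd qo]] := leaf_path_enum lP.
  have [r [_ _ rP rd ro]] := leaf_path_enum lP'.
  have [i il xq] := (qP x).1 xP; have [j jl xr] := (rP x).1 xP'.
  have [/andP[_ il'] /andP[_ jl']] := (il, jl).
  have h1 := qo v' i (notin _ _ _ _ lP lP') il'.
  have h2 := ro v j (notin _ _ _ _ lP' lP) jl'.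
  have h3 := qo v i (notin _ _ _ _ lP lP) il'.
  have h4 := ro v' j (notin _ _ _ _ lP' lP') jl'.
  rewrite -xq -xr !distxx in h1 h2 h3 h4; apply: (dist_eq0 tree).
  by have := dist_sym tree v v'; lia.
split=> //; subst v'.
rewrite -(setD1K (leaf_path_start_in lP)) -(setD1K (leaf_path_start_in lP')).
by congr (_ |: _); apply/eqP; rewrite eqEsubset !sub.
Qed.

End LeafPaths.

(** * Sensors on leaf-paths, and trimming *)

Section LeafPathSensors.

Variables (T : finType) (e : rel T) (k : nat) (S : {set T}).
Hypotheses (tree : is_tree e) (resS : resolving e k S).

Local Notation d := (dist e).

Lemma resolving_cover x : exists2 s, s \in S & d x s <= k.
Proof.
have /andP[_ /forallP/(_ x)/existsP[s /andP[sS sx]]] := resS.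
by exists s; rewrite // (dist_sym tree).
Qed.

Lemma resolving_neq x y : x != y ->
  exists2 s, s \in S & minn (d x s) k.+1 != minn (d y s) k.+1.
Proof.
move=> xy; have /andP[/forallP/(_ x)/forallP/(_ y)/implyP/(_ xy)] := resS.
case/existsP=> s /andP[sS ne] _; exists s => //.
by rewrite (dist_sym tree x) (dist_sym tree y).
Qed.

(** Outside sensors are at distance at least [x] from position [x], hence useless at positions
    beyond [k]; [count_path_sensors] applies. *)
Lemma leaf_path_sensors v P : leaf_path e v P ->
  cund k (path_length P) <= #|S :&: (P :\ v)| /\
  (forall s, s \in S -> s \in P :\ v -> d v s <= k.+1 ->
     cbar k (path_length P) <= #|S :&: (P :\ v)|).
Proof.
move=> lP; have [q [l0 q0 qP qd qo]] := leaf_path_enum tree lP.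
set l := path_length P in l0 qP qd qo *; pose A i := q i \in S.
have qd' i j : i <= l -> j <= l -> d (q i) (q j) = (i - j) + (j - i).
  move=> il jl; have [ij|/ltnW ji] := leqP i j.
    by rewrite qd ?ij //; lia.
  by rewrite (dist_sym tree) qd ?ji //; lia.
have out s x : s \notin P :\ v -> x <= l -> x <= d (q x) s.
  by move=> sP xl; rewrite (dist_sym tree) qo // leq_addl.
have countA : count A (iota 1 l) <= #|S :&: (P :\ v)|.
  rewrite -size_filter -(size_map q) -(card_uniqP _).
    apply/subset_leq_card/subsetP => x /mapP[i].
    rewrite mem_filter mem_iota add1n ltnS => /andP[Ai il ->].
    by rewrite inE [_ \in S]Ai; apply/qP; exists i.
  rewrite map_inj_in_uniq ?filter_uniq ?iota_uniq // => i j.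
  rewrite !mem_filter !mem_iota => /andP[_ il] /andP[_ jl] qij.
  by have := qd' i j ltac:(lia) ltac:(lia); rewrite qij distxx; lia.
have [||h1 h2] := @count_path_sensors k l A.
- move=> x /andP[kx xl]; have [s sS sx] := resolving_cover (q x).
  have [/qP[i il sE]|sP] := boolP (s \in P :\ v); last first.
    by have := out s x sP xl; lia.
  have := qd' x i xl ltac:(lia); rewrite sE in sx sS; exists i; split=> //; lia.
- move=> x y kx /andP[xy yl]; have xl : x <= l by lia.
  have qxy : q x != q y.
    by apply/eqP => qxy; have := qd' x y xl yl; rewrite qxy distxx; lia.
  have [s sS ne] := resolving_neq qxy.
  have [/qP[i il sE]|sP] := boolP (s \in P :\ v); last first.
    by have := out s x sP xl; have := out s y sP yl; move: ne; lia.
  rewrite sE in sS ne; exists i; split=> //.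
  by rewrite -!qd' //; lia.
split=> [|s sS /qP[i il sE] si]; first exact: leq_trans countA.
apply: leq_trans countA; apply: (h2 i) => //; last by rewrite /A -sE.
by have := qd 0 i ltac:(lia); rewrite q0 -sE; lia.
Qed.

(** Only a sensor on [P] or [Q] tells their first vertices apart. At position [i] it sees them at
    distances i - 1 and i + 1, so truncation forces i - 1 <= k. *)
Lemma leaf_path_near_sensor v P Q : leaf_path e v P -> leaf_path e v Q ->
  P != Q -> exists2 s, s \in S & d v s <= k.+1 /\ (s \in P :\ v \/ s \in Q :\ v).
Proof.
move=> lP lQ PQ; have [p [l0 p0 pP pd po]] := leaf_path_enum tree lP.
have [q [m0 q0 qP qd qo]] := leaf_path_enum tree lQ.
have pP1 : p 1 \in P :\ v by apply/pP; exists 1.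
have qQ1 : q 1 \in Q :\ v by apply/qP; exists 1.
have pq : p 1 != q 1.
  apply/eqP => pq; rewrite -pq in qQ1; case/eqP: PQ.
  by have [] := leaf_path_disjoint tree lP lQ pP1 qQ1.
have [s sS ne] := resolving_neq pq; exists s => //.
rewrite ![d _ s](dist_sym tree) in ne.
have [sP|sP] := boolP (s \in P :\ v).
  have sQ : s \notin Q :\ v.
    apply/negP => sQ; case/eqP: PQ.
    by have [] := leaf_path_disjoint tree lP lQ sP sQ.
  split; last by left.
  have := qo s 1 sQ m0; have [i il sE] := (pP s).1 sP; have [i0 il'] := andP il.
  have := pd 1 i il; have := pd 0 i il'; rewrite p0 -sE.
  have := dist_sym tree s v; have := dist_sym tree s (p 1).
  by move: ne i0; clear; lia.
have p1 := po s 1 sP l0; have [sQ|sQ] := boolP (s \in Q :\ v); last first.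
  by rewrite p1 (qo s 1 sQ m0) eqxx in ne.
split; last by right.
have [i il sE] := (qP s).1 sQ; have [i0 il'] := andP il.
have := qd 1 i il; have := qd 0 i il'; rewrite q0 -sE.
have := dist_sym tree s v; have := dist_sym tree s (q 1).
by move: ne i0 p1; clear; lia.
Qed.

Lemma sum_cbar_le v :
  \sum_(P in leaf_paths e v) cbar k (path_length P) <=
  \sum_(P in leaf_paths e v) #|S :&: (P :\ v)| +
  \max_(P in leaf_paths e v) (cbar k (path_length P) - cund k (path_length P)).
Proof.
pose good P := [exists s in S, (s \in P :\ v) && (d v s <= k.+1)].
have lpP P : P \in leaf_paths e v -> leaf_path e v P by rewrite inE.
have goodP P : P \in leaf_paths e v -> good P ->
    cbar k (path_length P) <= #|S :&: (P :\ v)|.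
  move=> /lpP/leaf_path_sensors[_ h] /existsP[s /and3P[sS sP sv]].
  exact: h sS sP sv.
case: (pickP [pred P in leaf_paths e v | ~~ good P]) => [P0 /andP[/= P0v bad]|all].
  rewrite (bigD1 P0) //= [X in _ <= X + _](bigD1 P0) //=.
  set a := \sum_(_ | _) _; set b := \sum_(_ | _) _.
  have ab : a <= b.
    apply: leq_sum => P /andP[Pv PP]; apply: goodP => //.
    have [s sS [sv]] := leaf_path_near_sensor (lpP P Pv) (lpP P0 P0v) PP.
    case=> sP; first by apply/existsP; exists s; rewrite sS sP.
    by case/negP: bad; apply/existsP; exists s; rewrite sS sP.
  have [c0 _] := leaf_path_sensors (lpP _ P0v).
  set M := \max_(_ in _) _.
  have M0 : cbar k (path_length P0) - cund k (path_length P0) <= M.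
    exact: leq_bigmax_cond P0v.
  by move: ab c0 M0; clear; lia.
apply: leq_trans (leq_addr _ _); apply: leq_sum => P Pv; apply: goodP => //.
by have /= := all P; rewrite Pv /= => /negbFE.
Qed.

Definition trimmed : {set T} :=
  [set x | [forall v in FT e, forall P in leaf_paths e v, x \notin P :\ v]].

Lemma trimmedP x v P : x \in trimmed -> v \in FT e -> P \in leaf_paths e v ->
  x \notin P :\ v.
Proof. by rewrite inE => /forall_inP/(_ v) h vF; move/forall_inP: (h vF); apply. Qed.

Lemma card_trimmed (B : {set T}) :
  #|B| = #|B :&: trimmed| +
    \sum_(v in FT e) \sum_(P in leaf_paths e v) #|B :&: (P :\ v)|.
Proof.
(* Extension by [set0] turns the double sum into one over all pairs, with disjoint pieces. *)
pose F (vP : T * {set T}) := if (vP.1 \in FT e) && (vP.2 \in leaf_paths e vP.1)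
  then B :&: (vP.2 :\ vP.1) else set0.
have FP x vP : x \in F vP -> [/\ vP.1 \in FT e, vP.2 \in leaf_paths e vP.1,
    x \in B & x \in vP.2 :\ vP.1].
  rewrite /F; case: ifP => [/andP[? ?]|_]; last by rewrite inE.
  by rewrite in_setI => /andP[].
rewrite -(cardsID trimmed B); congr (_ + _).
rewrite pair_big_dep /=.
transitivity #|\bigcup_vP F vP|.
  apply: eq_card => x; apply/idP/bigcupP => [|[vP _ /FP[vF Pv xB xP]]].
    rewrite !inE => /andP[nx xB]; move: nx; rewrite negb_forall_in.
    case/exists_inP=> v vF; rewrite negb_forall_in => /exists_inP[P Pv].
    by rewrite negbK => xP; exists (v, P); rewrite // /F vF Pv in_setI xB.
  rewrite inE xB andbT; apply/negP => xt.
  by have := trimmedP xt vF Pv; rewrite xP.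
rewrite -sum1_card partition_disjoint_bigcup; last first.
  move=> [v P] [w Q] ne; rewrite -setI_eq0; apply/eqP/setP => x.
  rewrite [RHS]inE; apply/negP; rewrite in_setI => /andP[/FP[/= _ vP _ xP] /FP[/= _ wQ _ xQ]].
  rewrite inE in vP; rewrite inE in wQ.
  by have [vw PQ] := leaf_path_disjoint tree vP wQ xP xQ; rewrite vw PQ eqxx in ne.
rewrite [RHS]big_mkcond; apply: eq_bigr => vP _; rewrite sum1_card /F.
by case: ifP => // _; rewrite cards0.
Qed.

Lemma card_leaf_path_inner v P : P \in leaf_paths e v ->
  #|[set: T] :&: (P :\ v)| = path_length P.
Proof.
rewrite inE setTI => /leaf_path_start_in vP.
by rewrite /path_length [in RHS](cardsD1 v) vP.
Qed.

(* Seen from the trimmed tree, a sensor on a leaf-path at v gives no more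
   information than a sensor at v. *)
Lemma card_trimmed_resolved :
  3 * #|trimmed| + (k ^ 2 + k + (k %% 3 == 1)) <=
  #|(S :&: trimmed) :|: FT e| * (k ^ 2 + 4 * k + 3 + (k %% 3 == 1)).
Proof.
set S' := _ :|: _.
have proj s : s \in S -> exists2 s', s' \in S' & exists c,
    forall x, x \in trimmed -> d x s = d x s' + c.
  move=> sS; have [st|] := boolP (s \in trimmed).
    by exists s; [rewrite !in_setU in_setI sS st | exists 0 => x _; rewrite addn0].
  rewrite inE negb_forall_in => /exists_inP[v vF].
  rewrite negb_forall_in => /exists_inP[P Pv]; rewrite negbK => sP.
  exists v; first by rewrite in_setU vF orbT.
  have := Pv; rewrite inE => lP; have [q [_ _ qP _ qo]] := leaf_path_enum tree lP.
  have [i /andP[_ il] ->] := (qP s).1 sP.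
  by exists i => x xt; apply: qo => //; apply: trimmedP Pv.
apply: card_resolved tree _ _ _.
- have [_ _ T0 _ _] := tree; have [x _] := card_gt0P T0.
  have [s /proj[s' s'S _] _] := resolving_cover x.
  by apply/card_gt0P; exists s'.
- move=> x xt; have [s /proj[s' s'S [c h]] sx] := resolving_cover x.
  by exists s' => //; rewrite h // in sx; lia.
move=> x y xt yt /resolving_neq[s /proj[s' s'S [c h]] ne]; exists s' => //.
by rewrite !h // in ne; move: ne; lia.
Qed.

End LeafPathSensors.

(** * The lower bound for [Tmd] *)

Import Order.TTheory GRing.Theory Num.Theory.
Local Open Scope ring_scope.

Theorem theorem2p9 (T : finType) (e : rel T) (k : nat)
    (hT : is_tree e) (hk : (1 <= k)%N) :
  let n := #|T|%:Z in
  let i : int := (k %% 3 == 1)%N%:Z in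
  let total : int :=
    \sum_(v in FT e) \sum_(P in leaf_paths e v) (path_length P)%:Z in
  Num.ceil (((3 * n - 3 * total + k%:Z ^+ 2 + k%:Z + i)%:~R : rat)
            / (k%:Z ^+ 2 + 4 * k%:Z + 3 + i)%:~R)
    + \sum_(v in FT e) Rcost k (leaf_paths e v) - #|FT e|%:Z
  <= (Tmd e k)%:Z.
Proof.
cbv zeta; set total := \sum_(v in _) \sum_(P in _) _.
set n := #|T|%:Z; set i := Posz (_ == _).
have [[S resS <-] _] := TmdP e k.
have lower := card_trimmed_resolved hT resS.
set S' := _ :|: _ in lower.
have totalE : n = #|trimmed e|%:Z + total.
  rewrite /n -cardsT (card_trimmed hT [set: T]) setTI PoszD; congr (_ + _).
  rewrite /total (big_morph Posz PoszD (erefl _)); apply: eq_bigr => v _.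
  rewrite (big_morph Posz PoszD (erefl _)); apply: eq_bigr => P Pv.
  by rewrite (card_leaf_path_inner Pv).
have sensors : \sum_(v in FT e) Rcost k (leaf_paths e v)
    + #|S :&: trimmed e|%:Z <= #|S|%:Z.
  rewrite [#|S|](card_trimmed hT S) PoszD addrC lerD2l.
  rewrite (big_morph Posz PoszD (erefl _)); apply: ler_sum => v _.
  by rewrite /Rcost; have := sum_cbar_le hT resS v; lia.
have S'le : (#|S'| <= #|S :&: trimmed e| + #|FT e|)%N by apply: leq_card_setU.
(* Passing from [S] to [S'] saves at least the sum of the R(L_v) and adds at most |F_T| sensors. *)
suff ceilS' : Num.ceil (((3 * n - 3 * total + k%:Z ^+ 2 + k%:Z + i)%:~R : rat)
    / (k%:Z ^+ 2 + 4 * k%:Z + 3 + i)%:~R) <= #|S'|%:Z by lia.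
have den0 : 0 < k%:Z ^+ 2 + 4 * k%:Z + 3 + i by nia.
rewrite ceil_le_int ler_pdivrMr ?ltr0z // -intrM ler_int totalE.
by move: lower; rewrite /i; nia.
Qed.
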